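(* Let $r,c$ be odd positive integers and let $h$ be a white vertex of the $r\times c$ grid graph. Let $a(r,c;h)$ be the number of near-perfect matchings of the grid in which $h$ is unmatched. Then $a(r,c;h)$ is odd if and only if all three of the following hold: (i) at least one of $r$ or $c$ is congruent to $1$ mod $4$; (ii) $\gcd(r+1,c+1)=2$; and (iii) $h$ is odd.
   Context: The $r\times c$ grid graph has vertex set $\{1,\dots,r\}\times\{1,\dots,c\}$, with two vertices adjacent when they differ by $1$ in exactly one coordinate. A near-perfect matching is a set of pairwise disjoint edges covering all vertices but one. With $r,c$ odd, color the grid in checkerboard fashion; a vertex is white if it has the majority color (i.e. vertex $(i,j)$ is white iff $i+j$ is even), otherwise black. A white vertex $(i,j)$ (whose two coordinates then have the same parity) is called odd if $i$ and $j$ are odd and even if $i$ and $j$ are even; in particular all white vertices on the boundary are odd. *)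

(* Defs.v *)
From mathcomp Require Import all_boot.

Set Implicit Arguments.
Unset Strict Implicit.
Unset Printing Implicit Defensive.

Section Matchings.

Variables (T : finType) (adj : rel T).

Definition edges : {set {set T}} :=
  [set e : {set T} | [exists x, exists y, adj x y && (e == [set x; y])]].

Definition matching (M : {set {set T}}) : bool :=
  (M \subset edges) && trivIset M.

Definition near_perfect (M : {set {set T}}) : bool :=
  matching M && [exists v, cover M == [set~ v]].

Definition near_perfect_count (h : T) : nat :=
  #|[set M : {set {set T}} | near_perfect M & h \notin cover M]|.

End Matchings.

(* Vertices are pairs of ordinals, which start at 0; [row] and [col] are the
   coordinates in {1, ..., r} and {1, ..., c}. *)
Definition grid (r c : nat) : finType := ('I_r * 'I_c)%type.

Definition row r c (v : grid r c) : nat := v.1.+1.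
Definition col r c (v : grid r c) : nat := v.2.+1.

Definition differ_by_one (m n : nat) : bool := (m.+1 == n) || (n.+1 == m).

Definition grid_adj r c : rel (grid r c) := fun u v =>
  (row u == row v) && differ_by_one (col u) (col v)
  || (col u == col v) && differ_by_one (row u) (row v).

Lemma differ_by_oneC m n : differ_by_one m n = differ_by_one n m.
Proof. by rewrite /differ_by_one orbC. Qed.

Lemma differ_by_onenn n : differ_by_one n n = false.
Proof. by rewrite /differ_by_one orbb; apply: gtn_eqF. Qed.

Lemma grid_adj_sym r c : symmetric (@grid_adj r c).
Proof.
move=> u v; rewrite /grid_adj (eq_sym (row u)) (eq_sym (col u)).
by rewrite (differ_by_oneC (row u)) (differ_by_oneC (col u)).
Qed.

Lemma grid_adj_irr r c : irreflexive (@grid_adj r c).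
Proof. by move=> u; rewrite /grid_adj !differ_by_onenn !andbF. Qed.

Definition white r c (v : grid r c) : bool := ~~ odd (row v + col v).

Definition odd_vertex r c (v : grid r c) : bool := odd (row v) && odd (col v).

Definition grid_count r c (h : grid r c) : nat :=
  near_perfect_count (@grid_adj r c) h.

(* Main.v *)
Require Import Defs.
From mathcomp Require Import all_boot.
From mathcomp Require Import all_fingroup all_algebra zify ring.

(** Over F_2, let A be the adjacency matrix of the grid and let A_h be A with
    its row and column h replaced by those of the identity. Pairing each
    permutation with its inverse in the expansion of det A_h leaves the
    involutions, that is the near-perfect matchings missing h; so their number
    is odd iff no nonzero x satisfies x h = 0 and (A x) v = 0 for all v <> h.
    The indicator of the odd vertices lies in ker A: this rules out every h
    that is not odd, and for odd h it gives (A x) h = 0 for all such x.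
    So everything depends on ker A. Viewed as a matrix, x is in ker A iff
    P_r x = x P_c, where P_n is the adjacency matrix of the path on n vertices.
    The Fibonacci polynomial F_(n+1) kills P_n, and by strong divisibility
    x F_g(P_c) = 0 for g = gcd(r+1, c+1). For g = 2 this is x P_c = 0, which
    leaves only the multiples of the indicator. For g > 2 reflected diagonals
    provide another kernel vector. *)

Set Implicit Arguments.
Unset Strict Implicit.
Unset Printing Implicit Defensive.

Import GRing.Theory.
Local Open Scope ring_scope.

(** * Permutation counts modulo 2 *)

Lemma odd_card_involution (T : finType) (f : T -> T) (A : {set T}) :
  involutive f -> {in A, forall x, f x \in A} ->
  odd #|A| = odd #|[set x in A | f x == x]|.
Proof.
move=> fK; have [n] := ubnP #|A|; elim: n A => // n IHn A leAn fA.
have [fixA | /set0Pn[x]] := eqVneq [set x in A | f x != x] set0.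
  congr (odd #|pred_of_set _|); apply/setP=> x; rewrite inE.
  have [Ax|//] := boolP (x \in A); apply/esym/negPn/negP=> fx.
  by have := in_set0 x; rewrite -fixA inE Ax fx.
rewrite inE => /andP[Ax fx].
have fAx : f x \in A :\ x by rewrite !inE fx fA.
have cardA : #|A| = #|A :\ x :\ f x|.+2.
  by rewrite (cardsD1 x) Ax (cardsD1 (f x) (A :\ x)) fAx.
rewrite cardA /= negbK IHn.
- congr (odd #|pred_of_set _|); apply/setP=> y; rewrite !inE.
  have [->|] := eqVneq y (f x); first by rewrite fK (eq_sym x) (negPf fx) !andbF.
  by have [->|//] := eqVneq y x; rewrite (negPf fx) !andbF.
- by move: leAn; rewrite cardA ltnS => /ltnW.
- move=> y; rewrite !inE => /and3P[yfx yx Ay].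
  by rewrite fA // andbT (can_eq fK) yx (can2_eq fK fK).
Qed.

Section PermanentF2.

Variables (T : finType) (e : rel T).

Definition rel_mx : 'M['F_2]_#|T| :=
  \matrix_(i, j) (e (enum_val i) (enum_val j))%:R.

Definition rel_perms : {set {perm T}} := [set s : {perm T} | [forall x, e x (s x)]].

Let ord_perm_inj (s : {perm T}) : injective (fun i : 'I_#|T| => enum_rank (s (enum_val i))).
Proof. by move=> i j /enum_rank_inj/perm_inj/enum_val_inj. Qed.

Let fin_perm_inj (s : 'S_#|T|) : injective (fun x => enum_val (s (enum_rank x))).
Proof. by move=> x y /enum_val_inj/perm_inj/enum_rank_inj. Qed.

Lemma F2_eq0 (n : nat) : (n%:R == 0 :> 'F_2)%R = ~~ odd n.
Proof. by rewrite -(dvdn_pcharf (pchar_Fp (isT : prime 2))) dvdn2. Qed.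

(** Signs vanish in characteristic 2, so the determinant is the permanent, and a permutation
    contributes 1 exactly when it respects [e] everywhere. *)
Lemma det_rel_mx : (\det rel_mx = #|rel_perms|%:R)%R.
Proof.
rewrite /determinant (reindex (fun s => perm (@ord_perm_inj s))) /=; last first.
  exists (fun s => perm (@fin_perm_inj s)) => s _; apply/permP=> i;
  by rewrite !permE /= ?permE ?(enum_valK, enum_rankK).
rewrite -[X in X%:R]sum1_card natr_sum [RHS]big_mkcond /=; apply: eq_bigr => s _.
have -> : ((-1 : 'F_2) = 1)%R by apply/val_inj.
rewrite expr1n mul1r inE (reindex enum_rank) /=; last first.
  by apply: onW_bij; exact: enum_rank_bij.
under eq_bigr => x _ do rewrite mxE permE enum_rankK enum_rankK.
case: ifPn => [/forallP e_s|].
  by rewrite big1 // => x _; rewrite e_s.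
by rewrite negb_forall => /existsP[x /negPf ex]; rewrite (bigD1 x) //= ex mul0r.
Qed.

(** Symmetry of [e] makes [rel_perms] stable under inversion, whose fixed points are the involutive
    permutations. *)
Lemma odd_rel_perms : symmetric e ->
  odd #|rel_perms| = odd #|[set s in rel_perms | [forall x, s (s x) == x]]|.
Proof.
move=> e_sym; rewrite (@odd_card_involution _ invg) //; first last.
- move=> s; rewrite !inE => /forallP e_s; apply/forallP=> x.
  by rewrite e_sym -{2}(permKV s x).
- exact: invgK.
congr (odd #|pred_of_set _|); apply/setP=> s; rewrite !inE; congr (_ && _).
apply/eqP/forallP=> [sV x | sK]; first by rewrite -{1}sV permK.
by apply/permP=> x; apply: (@perm_inj _ s); rewrite permKV (eqP (sK x)).
Qed.

End PermanentF2.

(** * Near-perfect matchings as involutions *)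

Section NearPerfect.

Variables (T : finType) (adj : rel T) (h : T).
Hypotheses (adj_sym : symmetric adj) (adj_irr : irreflexive adj).

(** The graph with [h] cut off and given a loop: its matrix is A_h, and every permutation respecting
    it fixes [h]. *)
Definition isolate : rel T := fun x y =>
  if (x == h) || (y == h) then (x == h) && (y == h) else adj x y.

Lemma isolate_sym : symmetric isolate.
Proof. by move=> x y; rewrite /isolate orbC andbC adj_sym. Qed.

Definition perm_edges (s : {perm T}) : {set {set T}} :=
  [set [set x; s x] | x in [set~ h]].

Definition involutions := [set s in rel_perms isolate | [forall x, s (s x) == x]].

Lemma involutionsP (s : {perm T}) :
  reflect [/\ s h = h, forall x, x != h -> adj x (s x) & involutive s]
          (s \in involutions).
Proof.
rewrite !inE; apply: (iffP andP) => [[/forallP e_s /forallP sK] | [sh s_adj sK]].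
  have sh : s h = h by have := e_s h; rewrite /isolate eqxx /= => /eqP.
  split=> // [x xh | x]; last exact/eqP.
  by have := e_s x; rewrite /isolate -{2}sh (inj_eq perm_inj) (negPf xh).
split; apply/forallP=> x; last by rewrite sK.
rewrite /isolate -{2 4}sh (inj_eq perm_inj).
by case: eqP => //= /eqP/s_adj.
Qed.

Lemma perm_edges_inj : {in involutions &, injective perm_edges}.
Proof.
move=> s t /involutionsP[sh s_adj sK] /involutionsP[th t_adj tK] eq_st.
apply/permP=> x; have [->|xh] := eqVneq x h; first by rewrite sh th.
have : [set x; s x] \in perm_edges t by rewrite -eq_st; apply: imset_f; rewrite !inE.
case/imsetP=> y _ eq_xy.
have eqx : [set x; s x] = [set x; t x].
  rewrite eq_xy; have: x \in [set y; t y] by rewrite -eq_xy !inE eqxx.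
  by rewrite !inE => /orP[] /eqP->; rewrite ?tK // setUC.
have: s x \in [set x; t x] by rewrite -eqx !inE eqxx orbT.
rewrite !inE => /orP[/eqP sx | /eqP//].
by have := s_adj x xh; rewrite sx adj_irr.
Qed.

Lemma perm_edges_near_perfect (s : {perm T}) : s \in involutions ->
  near_perfect adj (perm_edges s) && (h \notin cover (perm_edges s)).
Proof.
case/involutionsP=> sh s_adj sK.
have covE : cover (perm_edges s) = [set~ h].
  apply/setP=> x; rewrite !inE; apply/bigcupP/idP=> [[_ /imsetP[y yh ->]] | xh].
    rewrite !inE in yh *; case/orP=> /eqP-> //.
    by rewrite -sh (inj_eq perm_inj).
  by exists [set x; s x]; [apply: imset_f; rewrite !inE | rewrite !inE eqxx].
rewrite covE !inE eqxx andbT /near_perfect /matching.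
apply/andP; split; last by apply/existsP; exists h; rewrite covE.
apply/andP; split.
  apply/subsetP=> _ /imsetP[x xh ->]; rewrite inE.
  apply/existsP; exists x; apply/existsP; exists (s x).
  by rewrite eqxx andbT s_adj //; rewrite !inE in xh.
apply/trivIsetP=> _ _ /imsetP[x xh ->] /imsetP[y yh ->].
apply: contraNT => /pred0Pn[z /andP[/= zx zy]].
have pairE u : [set u; s u] = [set s u; s (s u)] by rewrite sK setUC.
have key u v : v \in [set u; s u] -> [set u; s u] = [set v; s v].
  by rewrite !inE => /orP[] /eqP->.
by rewrite (key x z zx) (key y z zy).
Qed.

Lemma involutions_surj (M : {set {set T}}) :
  near_perfect adj M -> h \notin cover M ->
  exists2 s, s \in involutions & M = perm_edges s.
Proof.
case/andP=> /andP[/subsetP M_edges M_triv] /existsP[v /eqP covM].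
rewrite covM !inE negbK => /eqP hv; rewrite -hv in covM; clear v hv.
(* The other end of the edge at [x]. The default matters at [h] only: its block is empty, so
   [partner] fixes [h]. *)
pose partner x := odflt x [pick y in pblock M x | y != x].
have blockP x : x != h -> exists2 y, adj x y & pblock M x = [set x; y].
  move=> xh; have Mx: x \in cover M by rewrite covM !inE.
  have /M_edges := pblock_mem Mx.
  rewrite inE => /existsP[a /existsP[b /andP[ab /eqP Mab]]].
  move: Mx; rewrite -mem_pblock Mab !inE => /orP[] /eqP->; first by exists b.
  by exists a; rewrite 1?adj_sym // setUC.
have adj_neq x y : adj x y -> x != y.
  by move=> xy; apply/eqP=> eq_xy; rewrite eq_xy adj_irr in xy.
have partnerE x y : x != y -> pblock M x = [set x; y] -> partner x = y.
  move=> xy Mx; rewrite /partner; case: pickP => [z|/(_ y)]; rewrite Mx !inE.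
    by case/andP=> /orP[] /eqP-> //=; rewrite eqxx.
  by rewrite eqxx orbT eq_sym xy.
have partner_h : partner h = h.
  rewrite /partner; case: pickP => //= y /andP[Mhy _].
  have: h \in cover M.
    apply: contraLR Mhy; rewrite /pblock => Mh; case: pickP => [B /andP[MB hB]|_].
      by case/bigcupP: Mh; exists B.
    by rewrite inE.
  by rewrite covM !inE eqxx.
have partnerP x : x != h -> adj x (partner x) /\ pblock M x = [set x; partner x].
  by move=> /blockP[y xy Mx]; rewrite (partnerE _ _ (adj_neq _ _ xy) Mx).
have partnerK : involutive partner.
  move=> x; have [->|xh] := eqVneq x h; first by rewrite !partner_h.
  have [xy Mx] := partnerP x xh; apply: partnerE; first by rewrite eq_sym adj_neq.
  rewrite setUC -Mx; apply/same_pblock => //.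
  by rewrite Mx !inE eqxx orbT.
exists (perm (can_inj partnerK)).
  apply/involutionsP; split=> [|x xh|x]; rewrite !permE //.
  by case: (partnerP x xh).
apply/setP=> B; apply/idP/imsetP=> [MB | [x]].
  have [B0 | [x Bx]] := set_0Vmem B.
    have /M_edges := MB; rewrite inE => /existsP[a /existsP[b /andP[_ /eqP Bab]]].
    by have := in_set0 a; rewrite -B0 Bab !inE eqxx.
  have xh : x \in [set~ h] by rewrite -covM; apply/bigcupP; exists B.
  exists x => //; rewrite permE -(def_pblock M_triv MB Bx).
  by rewrite !inE in xh; case: (partnerP x xh).
move=> xh ->; rewrite permE; have xM : x \in cover M by rewrite covM.
by rewrite !inE in xh; have [_ <-] := partnerP x xh; apply: pblock_mem.
Qed.

Lemma near_perfect_count_involutions : near_perfect_count adj h = #|involutions|.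
Proof.
rewrite -(card_in_imset perm_edges_inj); apply: eq_card => M.
rewrite !inE; apply/andP/imsetP=> [[M_np Mh] | [s s_inv ->]].
  exact: involutions_surj.
exact/andP/perm_edges_near_perfect.
Qed.

Lemma odd_near_perfect_count :
  odd (near_perfect_count adj h) = (\det (rel_mx isolate) != 0).
Proof.
rewrite near_perfect_count_involutions -odd_rel_perms; last exact: isolate_sym.
by rewrite det_rel_mx F2_eq0 negbK.
Qed.

(** The count is even iff the isolated matrix has a nonzero left kernel vector. Column [h] reads
    [f h = 0]; given that, the other columns agree with those of the adjacency matrix. *)
Lemma even_near_perfect_countP :
  ~~ odd (near_perfect_count adj h) <->
  exists f : T -> 'F_2,
   [/\ exists x, f x != 0, f h = 0 &
     forall y, y != h -> \sum_(x | adj x y) f x = 0].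
Proof.
have sumE (f : T -> 'F_2) y : f h = 0 -> y != h ->
    \sum_(x | adj x y) f x = \sum_x f x * (isolate x y)%:R.
  move=> fh yh; rewrite big_mkcond; apply: eq_bigr => x _.
  rewrite /isolate (negPf yh) orbF andbF.
  have [->|_] := eqVneq x h; first by rewrite fh mul0r if_same.
  by case: ifP; rewrite (mulr1, mulr0).
have sum_h (f : T -> 'F_2) : \sum_x f x * (isolate x h)%:R = f h.
  rewrite (bigD1 h) //= big1 => [|x /negPf xh].
    by rewrite /isolate eqxx mulr1 addr0.
  by rewrite /isolate eqxx xh mulr0.
rewrite odd_near_perfect_count negbK; split=> [/det0P[v v0 vM] | [f [[x fx] fh fadj]]].
  pose f x : 'F_2 := v 0 (enum_rank x).
  have sum0 y : \sum_x f x * (isolate x y)%:R = 0.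
    have /rowP/(_ (enum_rank y)) := vM; rewrite !mxE => vM_y; rewrite -[RHS]vM_y.
    rewrite [RHS](reindex (@enum_rank T)); last by apply: onW_bij; exact: enum_rank_bij.
    by apply: eq_bigr => x _; rewrite !mxE !enum_rankK.
  have fh : f h = 0 by rewrite -sum_h sum0.
  exists f; split=> // [|y yh]; last by rewrite sumE.
  have [i vi] : exists i, v 0 i != 0 by apply/rV0Pn.
  by exists (enum_val i); rewrite /f enum_valK.
apply/det0P; exists (\row_i f (enum_val i)).
  by apply/rV0Pn; exists (enum_rank x); rewrite mxE enum_rankK.
apply/rowP=> j; rewrite !mxE.
transitivity (\sum_x f x * (isolate x (enum_val j))%:R).
  rewrite [RHS](reindex (@enum_val T predT)); last by apply: onW_bij; exact: enum_val_bij.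
  by apply: eq_bigr => i _; rewrite !mxE.
have [->|jh] := eqVneq (enum_val j) h; first by rewrite sum_h.
by rewrite -sumE // fadj.
Qed.
End NearPerfect.

(** * Fibonacci polynomials over F_2 *)

Lemma addF2 (x : 'F_2) : x + x = 0.
Proof. exact: addrr_pchar2 (pchar_Fp (isT : prime 2)) x. Qed.

Lemma oppF2 (x : 'F_2) : - x = x.
Proof. exact: oppr_pchar2 (pchar_Fp (isT : prime 2)) x. Qed.

(** Modulo 2, [fibp n.+1] is also the characteristic polynomial of the path on n vertices. *)
Fixpoint fibp (n : nat) : {poly 'F_2} :=
  if n is m.+1 then if m is k.+1 then 'X * fibp m + fibp k else 1 else 0.

Lemma fibpSS n : fibp n.+2 = 'X * fibp n.+1 + fibp n.
Proof. by []. Qed.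

Lemma fibp_add m n : fibp (m + n).+1 = fibp m.+1 * fibp n.+1 + fibp m * fibp n.
Proof.
suff [] : fibp (m + n).+1 = fibp m.+1 * fibp n.+1 + fibp m * fibp n /\
  fibp (m + n).+2 = fibp m.+2 * fibp n.+1 + fibp m.+1 * fibp n by [].
elim: m => [|m [IH1 IH2]].
  by rewrite !add0n !fibpSS /= mulr1 addr0 !mul1r mul0r addr0.
split; first by rewrite addSn.
rewrite addSn fibpSS IH1 IH2 (fibpSS m.+1) (fibpSS m); ring.
Qed.

Lemma coprimep_fibp n : coprimep (fibp n) (fibp n.+1).
Proof.
elim: n => [|n IHn]; first exact: coprimep1.
apply/coprimepP=> d d1; rewrite fibpSS dvdp_addr ?dvdp_mull // => d2.
by move/coprimepP: IHn; apply.
Qed.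

Lemma dvdp_fibp_sub (d : {poly 'F_2}) m n :
  d %| fibp n -> d %| fibp (m + n) -> d %| fibp m.
Proof.
case: n => [|n] dn; first by rewrite addn0.
rewrite addnS fibp_add dvdp_addr; last exact: dvdp_mull.
rewrite Gauss_dvdpl //; apply: coprimep_dvdr dn _.
by rewrite coprimep_sym coprimep_fibp.
Qed.

(** Euclid's subtractive algorithm, run on the indices. *)
Lemma dvdp_fibp_gcd (d : {poly 'F_2}) m n :
  d %| fibp m -> d %| fibp n -> d %| fibp (gcdn m n).
Proof.
have [k] := ubnP (m + n); elim: k m n => // k IHk m n lek.
wlog le_nm : m n lek / (n <= m)%N => [th dm dn|dm dn].
  have [/th|/ltnW/th] := leqP n m; first exact.
  by rewrite gcdnC addnC; apply.
case: (posnP n) => [->|n_gt0]; first by rewrite gcdn0.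
rewrite -(subnK le_nm) in dm *; rewrite gcdnC gcdnDr.
apply: IHk => //; first by lia.
exact: dvdp_fibp_sub dn dm.
Qed.

(** * Path adjacency matrices *)

Definition path_mx n : 'M['F_2]_n := \matrix_(i, j) (differ_by_one i j)%:R.

(** Positions are shifted to 1, ..., n; the zeros at 0 and n + 1 stand for the missing neighbours of
    the two ends. *)
Lemma sum_path n (f : nat -> 'F_2) (j : 'I_n) : f 0 = 0 -> f n.+1 = 0 ->
  \sum_(i < n) f i.+1 * path_mx n i j = f j + f j.+2.
Proof.
move=> f0 fn.
have -> : \sum_(i < n) f i.+1 * path_mx n i j =
   \sum_(i < n.+2) f i * (differ_by_one i j.+1)%:R.
  rewrite big_ord_recl f0 mul0r add0r big_ord_recr /= /bump fn mul0r addr0.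
  by apply: eq_bigr => i _; rewrite mxE.
have lt_j := ltn_ord j.
have lt1 : (j < n.+2)%N by lia. have lt2 : (j.+2 < n.+2)%N by lia.
rewrite (bigD1 (Ordinal lt1)) // (bigD1 (Ordinal lt2)) /=; last first.
  by rewrite -val_eqE /=; lia.
rewrite big1 ?addr0 => [|i]; last first.
  rewrite -!val_eqE /= => /andP[i1 i2].
  rewrite (_ : differ_by_one i j.+1 = false) ?mulr0 //.
  by rewrite /differ_by_one; lia.
by rewrite /differ_by_one !eqxx orbT !mulr1.
Qed.

Lemma path_mx_sym n : (path_mx n)^T = path_mx n.
Proof. by apply/matrixP=> i j; rewrite !mxE differ_by_oneC. Qed.

(** The recurrence moves the first basis row one step along the path: multiplying by P gives both
    neighbours, and adding the previous row cancels one. At k = n + 2 the row has left the path and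
    is zero. *)
Lemma delta_fibp_path n k : (k <= n.+2)%N ->
  delta_mx 0 0 *m horner_mx (path_mx n.+1) (fibp k) =
  \row_j (j.+1 == k)%:R :> 'rV_n.+1.
Proof.
suff H l : (l <= n.+1)%N ->
  delta_mx 0 0 *m horner_mx (path_mx n.+1) (fibp l) =
  \row_j (j.+1 == l)%:R :> 'rV_n.+1 /\
  delta_mx 0 0 *m horner_mx (path_mx n.+1) (fibp l.+1) =
  \row_j (j.+1 == l.+1)%:R :> 'rV_n.+1.
  by case: k => [_|k lek]; [have [] := H 0 isT | have [] := H k lek].
elim: l => [_|l IHl lel].
  rewrite /= rmorph0 mulmx0 rmorph1 mulmx1; split; apply/rowP=> j; rewrite !mxE //=.
have [IH1 IH2] := IHl (ltnW lel).
split=> //.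
rewrite fibpSS rmorphD mulmxDr IH1 mulrC rmorphM /= horner_mx_X.
rewrite -mulmxE mulmxA IH2; apply/rowP=> j; rewrite !mxE.
pose f i : 'F_2 := (i == l.+1)%:R.
under eq_bigr => i _ do rewrite [X in X * _]mxE -[X in X * _]/(f i.+1).
rewrite sum_path // /f; last by rewrite (_ : (_ == _) = false) //; lia.
by rewrite eqSS -addrA addF2 addr0.
Qed.

(** The first basis row is cyclic: row i is its image under [fibp i.+1]. Polynomials in P commute,
    so it is enough that [fibp n.+2] kills the first row. *)
Lemma horner_fibp_path n : horner_mx (path_mx n.+1) (fibp n.+2) = 0.
Proof.
apply/row_matrixP=> i; rewrite row0 rowE.
have -> : delta_mx 0 i = delta_mx 0 0 *m horner_mx (path_mx n.+1) (fibp i.+1) :> 'rV_n.+1.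
  rewrite delta_fibp_path; last exact: leqW.
  by apply/rowP=> j; rewrite !mxE eqSS.
rewrite -mulmxA mulmxE -rmorphM mulrC rmorphM -mulmxE mulmxA delta_fibp_path //.
rewrite (_ : \row_j _ = 0) ?mul0mx //; apply/rowP=> j; rewrite !mxE.
by rewrite eqSS ltn_eqF.
Qed.

Lemma horner_mx_intertwine (R : comNzRingType) m n
    (A : 'M[R]_m.+1) (B : 'M[R]_n.+1) (X : 'M[R]_(m.+1, n.+1)) (p : {poly R}) :
  A *m X = X *m B -> horner_mx A p *m X = X *m horner_mx B p.
Proof.
move=> AX; elim/poly_ind: p => [|p a IHp]; first by rewrite !rmorph0 mul0mx mulmx0.
rewrite !rmorphD !rmorphM /= !horner_mx_X !horner_mx_C mulmxDl mulmxDr.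
by rewrite -!mulmxE -mulmxA AX !mulmxA IHp scalar_mxC.
Qed.

(** Intertwining moves the polynomial killing the left path to the right of [X]. By Bezout, the gcd
    of both annihilators kills [X] too, hence so does its multiple [fibp (gcdn m.+2 n.+2)]. *)
Lemma annihilator_gcd m n (X : 'M['F_2]_(m.+1, n.+1)) :
  path_mx m.+1 *m X = X *m path_mx n.+1 ->
  X *m horner_mx (path_mx n.+1) (fibp (gcdn m.+2 n.+2)) = 0.
Proof.
move=> comX.
have Zm : X *m horner_mx (path_mx n.+1) (fibp m.+2) = 0.
  by rewrite -(horner_mx_intertwine _ comX) horner_fibp_path mul0mx.
have Zn : X *m horner_mx (path_mx n.+1) (fibp n.+2) = 0.
  by rewrite horner_fibp_path mulmx0.
set a := fibp m.+2 in Zm *; set b := fibp n.+2 in Zn *.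
have dvd_g : gcdp a b %| fibp (gcdn m.+2 n.+2).
  by rewrite dvdp_fibp_gcd ?dvdp_gcdl ?dvdp_gcdr.
clearbody a b; have [[u v] /= uv] := Bezoutp a b.
move: dvd_g; rewrite -(eqp_dvdl _ uv) => /dvdpP[q ->].
rewrite mulrC [u * _]mulrC [v * _]mulrC.
rewrite !(rmorphM, rmorphD) /=.
by rewrite -!mulmxE mulmxA mulmxDr !mulmxA Zm Zn !mul0mx addr0 mul0mx.
Qed.

Lemma path_mx_kernel m n (X : 'M['F_2]_(m, n.+1)) i j :
  X *m path_mx n.+1 = 0 -> X i j = if odd j then 0 else X i 0.
Proof.
move=> X0.
(* Row [i] shifted to positions 1, ..., n + 1 and framed by zeros. The kernel condition becomes f k
   = f (k + 2), so f vanishes at even k, that is at odd [j]. *)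
pose f k : 'F_2 := if k is l.+1 then if (l <= n)%N then X i (inord l) else 0 else 0.
have fE (k : 'I_n.+1) : f k.+1 = X i k by rewrite /f -ltnS ltn_ord inord_val.
have f0 : f 0 = 0 by [].
have fn : f n.+2 = 0 by rewrite /f ltnn.
clearbody f; have f2 k : (k <= n)%N -> f k = f k.+2.
  rewrite -ltnS => ltk; apply/eqP; rewrite -subr_eq0 oppF2; apply/eqP.
  rewrite -(@sum_path n.+1 f (Ordinal ltk)) //.
  transitivity ((X *m path_mx n.+1) i (Ordinal ltk)); last by rewrite X0 mxE.
  by rewrite mxE; apply: eq_bigr => l _; rewrite fE.
have fk k : (k <= n.+1)%N -> f k = if odd k then X i 0 else 0.
  have [l] := ubnP k; elim: l k => // l IHl [|[|k]] lel lek //=.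
    exact: (fE ord0).
  by rewrite negbK -f2 ?IHl //; lia.
by rewrite -fE fk //=; case: odd.
Qed.

(** * The kernel of the grid adjacency matrix *)

Definition grid_mx r c (x : grid r c -> 'F_2) : 'M['F_2]_(r, c) :=
  \matrix_(i, j) x (i, j).

Lemma sum_grid_adj r c (x : grid r c -> 'F_2) (v : grid r c) :
  \sum_(u | grid_adj u v) x u =
  (path_mx r *m grid_mx x + grid_mx x *m path_mx c) v.1 v.2.
Proof.
case: v => i j /=; rewrite big_mkcond !mxE.
(* A neighbour shares exactly one coordinate with (i, j), so the two summands never overlap. *)
have adjE u : (if grid_adj u (i, j) then x u else 0) =
    (u.2 == j)%:R * (path_mx r i u.1 * x (u.1, u.2))
    + (u.1 == i)%:R * (x (u.1, u.2) * path_mx c u.2 j).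
  case: u => k l; rewrite /grid_adj /Defs.row /Defs.col /= !mxE !eqSS.
  rewrite -(differ_by_oneC k) /differ_by_one !eqSS -!(val_eqE k) -!(val_eqE l) /=.
  case: (val k =P val i) => [->|_]; case: (val l =P val j) => [->|_];
    rewrite /= ?(gtn_eqF (ltnSn _)) /= ?mul0r ?addr0 ?add0r ?mul1r ?mulr0 //.
  - by rewrite addr0.
  - by rewrite orbF; case: (_ || _); rewrite (mulr1, mulr0).
  - by case: (_ || _); rewrite (mul1r, mul0r).
under eq_bigr => u _ do rewrite adjE.
rewrite big_split /=; congr (_ + _).
  rewrite -(pair_bigA _ (fun k l => (l == j)%:R * (path_mx r i k * x (k, l)))) /=.
  apply: eq_bigr => k _; rewrite (bigD1 j) //= eqxx mul1r big1 ?addr0 ?mxE //.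
  by move=> l /negPf->; rewrite mul0r.
rewrite -(pair_bigA _ (fun k l => (k == i)%:R * (x (k, l) * path_mx c l j))) /=.
rewrite (bigD1 i) //= [X in _ + X]big1 ?addr0 => [|k /negPf ki]; last first.
  by rewrite big1 // => l _; rewrite ki mul0r.
by apply: eq_bigr => l _; rewrite eqxx mul1r !mxE.
Qed.

Definition kernel r c (x : grid r c -> 'F_2) :=
  forall v, \sum_(u | grid_adj u v) x u = 0.

Lemma kernel_comm r c (x : grid r c -> 'F_2) :
  kernel x -> path_mx r *m grid_mx x = grid_mx x *m path_mx c.
Proof.
move=> x_ker; apply/matrixP=> i j; have /eqP := x_ker (i, j).
by rewrite sum_grid_adj mxE addr_eq0 oppF2 => /eqP.
Qed.

(** Framing the grid by zeros turns membership in the kernel into one local identity, without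
    boundary cases. *)
Lemma kernel_frame r c (f : nat -> nat -> 'F_2) :
  (forall j, f 0 j = 0) -> (forall j, f r.+1 j = 0) ->
  (forall i, f i 0 = 0) -> (forall i, f i c.+1 = 0) ->
  (forall i j, f i j.+1 + f i.+2 j.+1 + (f i.+1 j + f i.+1 j.+2) = 0) ->
  kernel (fun v : grid r c => f (Defs.row v) (Defs.col v)).
Proof.
move=> f0j frj fi0 fic harm [i j].
rewrite sum_grid_adj mxE [X in X + _]mxE [X in _ + X]mxE -[RHS](harm i j).
rewrite -(@sum_path r (f^~ j.+1)) // -(@sum_path c (f i.+1)) //=.
congr (_ + _); apply: eq_bigr => k _; rewrite !mxE //.
by rewrite mulrC differ_by_oneC.
Qed.

Lemma kernel_odd_vertex r c : odd r -> odd c ->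
  kernel (fun v : grid r c => (odd_vertex v)%:R).
Proof.
move=> r_odd c_odd.
apply: (@kernel_frame r c (fun i j => (odd i && odd j)%:R)) => //= [j|i|i|i j].
- by rewrite r_odd.
- by rewrite andbF.
- by rewrite c_odd andbF.
- by rewrite !negbK addF2 add0r addF2.
Qed.

(** Add [a] to both sides: twice a multiple of d is 0 modulo 2d. *)
Lemma eqn_mod_double d a b :
  (d %| a)%N -> (a == b %[mod d.*2])%N = (d.*2 %| a + b)%N.
Proof.
case/dvdnP=> k ->; rewrite -(eqn_modDr (k * d)) addnn -mul2n mulnCA mul2n.
by rewrite modnMl eq_sym addnC.
Qed.

(* The path of a diagonal ray reflected at the lines where d divides i or j:
   on each such line its two summands coincide, hence cancel. *)
Definition billiard d i j : 'F_2 :=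
  (i == j %[mod d.*2])%N%:R + (d.*2 %| i + j)%N%:R.

Lemma billiardC d i j : billiard d i j = billiard d j i.
Proof. by rewrite /billiard eq_sym addnC. Qed.

Lemma billiard0 d i j : (d %| i)%N -> billiard d i j = 0.
Proof. by move=> d_i; rewrite /billiard eqn_mod_double // addF2. Qed.

Lemma kernel_billiard r c d : (d %| r.+1)%N -> (d %| c.+1)%N ->
  kernel (fun v : grid r c => billiard d (Defs.row v) (Defs.col v)).
Proof.
move=> d_r d_c.
apply: (@kernel_frame r c (billiard d)) => [j|j|i|i|i j].
- exact: billiard0.
- exact: billiard0.
- by rewrite billiardC billiard0.
- by rewrite billiardC billiard0.
rewrite /billiard; have modS a b : (a.+1 == b.+1 %[mod d.*2])%N = (a == b %[mod d.*2])%N.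
  by rewrite -(addn1 a) -(addn1 b) eqn_modDr.
rewrite !modS !addSn !addnS.
set a := _%:R; set b := _%:R; set a' := _%:R; set b' := _%:R.
(* Among the four neighbours, each of the two differences and each of the two sums occurs twice. *)
rewrite -[RHS](addF2 (a + b + (a' + b'))); ring.
Qed.

Lemma kernel_gcd2 r c (x : grid r.+1 c.+1 -> 'F_2) v :
  gcdn r.+2 c.+2 = 2 -> kernel x ->
  x v = if odd_vertex v then x (ord0, ord0) else 0.
Proof.
move=> g2 x_ker; have comX := kernel_comm x_ker.
(* [fibp 2] is the indeterminate, so x P_c = 0; by commutation P_r x = 0 as well, and rows and
   columns both alternate with 0. *)
have := annihilator_gcd comX; rewrite g2 /= mulr1 addr0 horner_mx_X => XP.
have /(congr1 trmx) := comX; rewrite XP trmx_mul path_mx_sym trmx0 => PX.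
case: v => i j; rewrite /odd_vertex /Defs.row /Defs.col /=.
have := path_mx_kernel i j XP; have := path_mx_kernel 0 i PX; rewrite !mxE => -> ->.
by case: odd; case: odd.
Qed.

(** Pair [w] with A f. By symmetry of A this equals the pairing of A w = 0 with f, while only the
    term at [h] survives, with coefficient 1. *)
Lemma kernel_at (T : finType) (adj : rel T) (f w : T -> 'F_2) h :
  symmetric adj -> (forall y, \sum_(x | adj x y) w x = 0) -> w h = 1 ->
  (forall y, y != h -> \sum_(x | adj x y) f x = 0) ->
  \sum_(x | adj x h) f x = 0.
Proof.
move=> adj_sym w0 wh f0.
transitivity (\sum_y w y * \sum_(x | adj x y) f x).
  rewrite [RHS](bigD1 h) //= wh mul1r [X in _ + X]big1 ?addr0 // => y /f0->.
  by rewrite mulr0.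
under eq_bigr => y _ do rewrite big_distrr /=.
rewrite (exchange_big_dep predT) //= big1 // => x _.
rewrite -big_distrl /= (_ : \sum_(y | _) _ = 0) ?mul0r //.
by rewrite -[RHS](w0 x); apply: eq_bigl => y; rewrite adj_sym.
Qed.

(** * Parity of the grid count *)

Lemma F2_neq0 (x : 'F_2) : x != 0 -> x = 1.
Proof. by case: x => [[|[|n]] //= lt_n] _; apply/val_inj. Qed.

Lemma odd_grid_count r c (h : grid r c) : odd r -> odd c ->
  odd (grid_count h) = (gcdn r.+1 c.+1 == 2)%N && odd_vertex h.
Proof.
case: r h => // r; case: c => // c h r_odd c_odd.
have symG := @grid_adj_sym r.+1 c.+1; have irrG := @grid_adj_irr r.+1 c.+1.
have evenP := even_near_perfect_countP h symG irrG.
pose w (v : grid r.+1 c.+1) : 'F_2 := (odd_vertex v)%:R.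
have w_ker : kernel w by exact: kernel_odd_vertex.
have [h_odd|h_even] := boolP (odd_vertex h); last first.
  rewrite andbF; apply/negbTE/evenP; exists w; split=> //.
    by exists (ord0, ord0).
  by rewrite /w (negPf h_even).
have wh : w h = 1 by rewrite /w h_odd.
rewrite andbT; have [g2|g_neq2] := eqVneq.
  apply/negPn/negP=> /evenP[f [[v fv] fh f0]].
  have f_ker : kernel f.
    move=> y; have [->|] := eqVneq y h; last exact: f0.
    exact: kernel_at wh f0.
  (* At the odd vertex [h], [f] takes its corner value, so [f h = 0] makes [f] vanish everywhere. *)
  have := kernel_gcd2 h g2 f_ker; rewrite fh h_odd => f00.
  by move: fv; rewrite (kernel_gcd2 v g2 f_ker) -f00 if_same eqxx.
set g := gcdn r.+2 c.+2 in g_neq2.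
have g_dvd_r : (g %| r.+2)%N := dvdn_gcdl _ _.
have g_dvd_c : (g %| c.+2)%N := dvdn_gcdr _ _.
have g_even : (2 %| g)%N by rewrite dvdn_gcd !dvdn2 /= !negbK; apply/andP.
have g_ge4 : (4 <= g)%N.
  have : (0 < g)%N by rewrite gcdn_gt0.
  by case/dvdnP: g_even => k; lia.
clearbody g; have c_ge : (2 < c.+1)%N by have := dvdn_leq (ltn0Sn _) g_dvd_c; lia.
pose b (v : grid r.+1 c.+1) := billiard g (Defs.row v) (Defs.col v).
have b_ker : kernel b by exact: kernel_billiard.
have b00 : b (ord0, ord0) = 1.
  by rewrite /b /billiard /Defs.row /Defs.col /= eqxx gtnNdvd ?addr0 //; lia.
(* The vertex (1, 3) separates [b] from [w]: there [b] is 0 because 2g is at least 8, while [w] is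
   1. *)
pose v2 : grid r.+1 c.+1 := (ord0, Ordinal c_ge).
have b02 : b v2 = 0.
  rewrite /b /billiard /Defs.row /Defs.col /= gtnNdvd //; last by lia.
  by rewrite !modn_small ?addr0 //; lia.
(* One of [b] and [b + w] vanishes at [h]; the corner shows that the first is nonzero, [v2] the
   second. *)
apply/negbTE/evenP; have [bh | /F2_neq0 bh] := eqVneq (b h) 0.
  by exists b; split=> //; exists (ord0, ord0); rewrite b00.
exists (fun v => b v + w v); split; first by exists v2; rewrite b02.
  by rewrite bh wh addF2.
by move=> y _; rewrite big_split /= b_ker w_ker addr0.
Qed.

Local Close Scope ring_scope.

Theorem theorem5 (r c : nat) (hr : odd r) (hc : odd c)
    (h : grid r c) (hw : white h) :
  odd (grid_count h) <->
  [/\ r = 1 %[mod 4] \/ c = 1 %[mod 4],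
      gcdn r.+1 c.+1 = 2
    & odd_vertex h].
Proof.
rewrite odd_grid_count //; split=> [/andP[/eqP g2 h_odd] | [_ -> ->] //].
split=> //; have [r1 | r3] := eqVneq (r %% 4) 1; first by left.
have [c1 | c3] := eqVneq (c %% 4) 1; first by right.
(* Both sizes are now 3 modulo 4. *)
have : 4 %| gcdn r.+1 c.+1 by rewrite dvdn_gcd; lia.
by rewrite g2.
Qed.
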